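(* Let $p$ be an odd prime, $K=\mathbb{Q}(\zeta)$ with $\zeta$ a primitive $p$-th root of unity, $v$ a primitive root modulo $p$ with $1\le v\le p-1$, and $G=\mathrm{Gal}(K/\mathbb{Q})=\langle\sigma\rangle$ with $\sigma(\zeta)=\zeta^v$. Let $P(\sigma)=\sum_{i=0}^{p-2}v_{-i}\,\sigma^i\in\mathbb{Z}[G]$. Then in $\mathbb{Z}[G]$ $$P(\sigma)\,(\sigma-v)=p\,Q(\sigma),$$ where $Q(\sigma)=\sum_{i=1}^{p-2}\delta_i\sigma^i\in\mathbb{Z}[G]$ with $$\delta_i=\frac{v_{-(i-1)}-v_{-i}\,v}{p}\qquad(1\le i\le p-2),$$ and $-p<\delta_i\le 0$ for all $i$.
   Context: For $n\in\mathbb{Z}$, $v_n$ denotes the integer with $v_n\equiv v^n\pmod p$ and $1\le v_n\le p-1$. *)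

(* Defs.v *)
From HB Require Import structures.
From mathcomp Require Import all_boot all_order all_algebra all_fingroup.
From mathcomp Require Import all_solvable all_field.

Set Implicit Arguments.
Unset Strict Implicit.
Unset Printing Implicit Defensive.

Import Order.TTheory GRing.Theory Num.Theory.
Local Open Scope ring_scope.

(* R[gT], for a whole finite group type gT. Multinomials' {malg R[M]} does not
   apply: its monoids must satisfy x * y = 1 -> x = 1 /\ y = 1. The carrier is
   an alias of {ffun gT -> R}, which already has the pointwise product. *)
Definition group_ring (R : nzRingType) (gT : finGroupType) := {ffun gT -> R}.

Definition group_elt {R : nzRingType} {gT : finGroupType} (g : gT) :
  group_ring R gT := [ffun h => (h == g)%:R].

Section GroupRing.
Variables (R : nzRingType) (gT : finGroupType).
Local Notation RG := (group_ring R gT).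
Implicit Types x y z : RG.

HB.instance Definition _ := GRing.Zmodule.copy RG {ffun gT -> R}.

Definition group_ring_mul x y : RG :=
  [ffun g => \sum_(h : gT) x h * y (h^-1 * g)%g].

Definition group_ring_scale (a : R) x : RG := [ffun g => a * x g].

Lemma group_ring_addE x y g : (x + y) g = x g + y g.
Proof. exact: ffunE. Qed.

Lemma group_ring_mulA : associative group_ring_mul.
Proof.
move=> x y z; apply/ffunP=> g; rewrite !ffunE.
under eq_bigr => h _ do rewrite ffunE mulr_sumr.
under [RHS]eq_bigr => h _ do rewrite ffunE mulr_suml.
rewrite exchange_big /= [RHS]exchange_big /= exchange_big /=.
apply: eq_bigr => h _; rewrite (reindex_inj (mulgI h^-1%g)) /=.
apply: eq_bigr => k _.
by rewrite mulrA invMg invgK -mulgA mulKVg.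
Qed.

Lemma group_ring_mul1 : left_id (group_elt 1%g) group_ring_mul.
Proof.
move=> x; apply/ffunP=> g; rewrite ffunE (bigD1 1%g) //= big1 => [|h /negPf h1].
  by rewrite ffunE eqxx mul1r invg1 mul1g addr0.
by rewrite ffunE h1 mul0r.
Qed.

Lemma group_ring_mulr1 : right_id (group_elt 1%g) group_ring_mul.
Proof.
move=> x; apply/ffunP=> g; rewrite ffunE (bigD1 g) //= big1 => [|h /negPf hg].
  by rewrite ffunE mulVg eqxx mulr1 addr0.
by rewrite ffunE -eq_mulVg1 hg mulr0.
Qed.

Lemma group_ring_mulDl : left_distributive group_ring_mul +%R.
Proof.
move=> x y z; apply/ffunP=> g; rewrite group_ring_addE !ffunE -big_split /=.
by apply: eq_bigr => h _; rewrite group_ring_addE mulrDl.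
Qed.

Lemma group_ring_mulDr : right_distributive group_ring_mul +%R.
Proof.
move=> x y z; apply/ffunP=> g; rewrite group_ring_addE !ffunE -big_split /=.
by apply: eq_bigr => h _; rewrite group_ring_addE mulrDr.
Qed.

Lemma group_ring_oner_neq0 : group_elt 1%g != 0 :> RG.
Proof.
apply/eqP => /ffunP/(_ 1%g); rewrite !ffunE eqxx => /eqP.
by rewrite oner_eq0.
Qed.

HB.instance Definition _ := GRing.Zmodule_isNzRing.Build RG
  group_ring_mulA group_ring_mul1 group_ring_mulr1
  group_ring_mulDl group_ring_mulDr group_ring_oner_neq0.

Lemma group_ring_scaleA a b x :
  group_ring_scale a (group_ring_scale b x) = group_ring_scale (a * b) x.
Proof. by apply/ffunP=> g; rewrite !ffunE mulrA. Qed.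

Lemma group_ring_scale1 : left_id 1 group_ring_scale.
Proof. by move=> x; apply/ffunP=> g; rewrite !ffunE mul1r. Qed.

Lemma group_ring_scaleDr : right_distributive group_ring_scale +%R.
Proof.
move=> a x y; apply/ffunP=> g.
by rewrite group_ring_addE !ffunE mulrDr.
Qed.

Lemma group_ring_scaleDl x : {morph group_ring_scale^~ x : a b / a + b}.
Proof.
by move=> a b; apply/ffunP=> g; rewrite group_ring_addE !ffunE mulrDl.
Qed.

HB.instance Definition _ := GRing.Zmodule_isLmodule.Build R RG
  group_ring_scaleA group_ring_scale1 group_ring_scaleDr group_ring_scaleDl.

Lemma group_ring_scaleAl (a : R) x y : a *: (x * y) = (a *: x) * y.
Proof.
apply/ffunP=> g; rewrite !ffunE mulr_sumr.
by apply: eq_bigr => h _; rewrite ffunE mulrA.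
Qed.

HB.instance Definition _ := GRing.Lmodule_isLalgebra.Build R RG
  group_ring_scaleAl.

Lemma group_elt1 : group_elt 1%g = 1 :> RG.
Proof. by []. Qed.

Lemma group_eltM g h : group_elt (g * h)%g = group_elt g * group_elt h :> RG.
Proof.
apply/ffunP=> k; rewrite !ffunE (bigD1 g) //= big1 => [|l /negPf lg].
  by rewrite !ffunE eqxx mul1r addr0 (can2_eq (mulKVg g) (mulKg g)).
by rewrite ffunE lg mul0r.
Qed.

Lemma group_eltX g n : group_elt (g ^+ n)%g = group_elt g ^+ n :> RG.
Proof. by elim: n => // n IHn; rewrite expgS exprS group_eltM IHn. Qed.

End GroupRing.

(* gal_of {:L} is all of Gal(L / F), so that group_ring R (gal_of {:L}) is
   R[Gal(L / F)]. *)
Lemma gal_fullT (F : fieldType) (L : splittingFieldType F) :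
  'Gal({:L} / 1)%g = [set: gal_of {:L}].
Proof.
apply/eqP; rewrite eqEsubset subsetT galois_connection ?sub1v //.
Qed.

Definition is_primitive_root_mod (p v : nat) : Prop :=
  p.-1.-primitive_root (v%:R : 'F_p).

(* v_n; the power is an integer power in 'F_p, so n may be negative. *)
Definition residue_pow (p v : nat) (n : int) : int :=
  Posz (val ((v%:R : 'F_p) ^ n)).

Lemma residue_powP (p v : nat) (n : int) : prime p -> (1 <= v <= p.-1)%N ->
  (residue_pow p v n)%:~R = v%:R ^ n :> 'F_p /\
  1 <= residue_pow p v n <= p%:Z - 1.
Proof.
move=> p_pr /andP[v1 vp]; have p0 := prime_gt0 p_pr.
have v_neq0 : (v%:R : 'F_p) != 0.
  rewrite -(dvdn_pcharf (pchar_Fp p_pr)); apply/negP => /dvdn_leq.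
  by move=> /(_ v1); rewrite leqNgt -(prednK p0) ltnS vp.
rewrite /residue_pow; set x := _ ^ n.
have x_neq0 : x != 0 by rewrite expfz_neq0.
have xp : (val x < p)%N.
  by have := ltn_ord x; rewrite [X in (_ < X)%N -> _](Fp_cast p_pr).
split; first by rewrite -[RHS]natr_Zp pmulrn.
rewrite lerBrDr -(PoszD _ 1) addn1 !lez_nat xp andbT lt0n.
by apply: contraNneq x_neq0 => x0; apply/eqP/val_inj.
Qed.

(* The quotient is exact, which is part of the theorem. *)
Definition delta_num (p v : nat) (i : nat) : int :=
  residue_pow p v (- (i%:Z - 1)) - residue_pow p v (- i%:Z) * v%:Z.

Definition delta (p v : nat) (i : nat) : int := (delta_num p v i %/ p%:Z)%Z.

(* Main.v *)
Require Import Defs.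
From HB Require Import structures.
From mathcomp Require Import all_boot all_order all_algebra all_fingroup.
From mathcomp Require Import all_solvable all_field.
From mathcomp Require Import zify.

Set Implicit Arguments.
Unset Strict Implicit.
Unset Printing Implicit Defensive.

Import Order.TTheory GRing.Theory Num.Theory.
Local Open Scope ring_scope.

(** Multiplying by sigma shifts the coefficients of P cyclically, because
    sigma ^+ p.-1 = 1: this element fixes zeta, which generates K, as
    v ^ p.-1 = 1 mod p. So the coefficient of sigma ^+ i in P * (sigma - v) is
    v_{-(i-1)} - v_{-i} * v for 1 <= i <= p - 2, which is p * delta_i since both
    terms are congruent to v ^ (1 - i). At i = 0 the shift wraps around and the
    coefficient is v_{-(p-2)} - v_0 * v = v_1 - v = 0, which is why Q has no
    constant term.

    For the bounds, residues lie between 1 and p - 1, so that the numerator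
    v_{-(i-1)} - v_{-i} * v is at most p - 2 < p and at least
    1 - (p - 1) ^ 2 > - p ^ 2; dividing by p gives - p < delta_i < 1.

    The lemmas that carry this are sum_periodic_powers_mulB for the shift,
    cyclotomic_gal_expg_eq1 for sigma ^+ p.-1 = 1, dvdz_delta_num for the
    congruence, residue_pow_wrap for v_{-(p-2)} = v, and delta_bounds. *)

(** Multiplication by x permutes its powers cyclically: the shifted sum keeps
    the exponents 1, ..., n - 1, and its last term a_(n-1) x^n falls back on
    the unit. The scalar c is a natural number so that it commutes with A, whose
    multiplication is only assumed to be compatible with scaling on the left. *)
Lemma sum_periodic_powers_mulB (R : comNzRingType) (A : lalgType R) (x : A)
    (a : nat -> R) (n c : nat) : (0 < n)%N -> x ^+ n = 1 ->
  (\sum_(0 <= i < n) a i *: x ^+ i) * (x - c%:R) =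
  (a n.-1 - a 0%N * c%:R)%:A +
    \sum_(1 <= i < n) (a i.-1 - a i * c%:R) *: x ^+ i.
Proof.
case: n => // n _ xn1; rewrite mulrBr.
have -> : (\sum_(0 <= i < n.+1) a i *: x ^+ i) * x =
    (a n)%:A + \sum_(1 <= i < n.+1) a i.-1 *: x ^+ i.
  rewrite mulr_suml big_add1 /= -xn1 addrC.
  under eq_bigr => i _ do rewrite -scalerAl -exprSr.
  by rewrite big_nat_recr.
have -> : (\sum_(0 <= i < n.+1) a i *: x ^+ i) * c%:R =
    (a 0%N * c%:R)%:A + \sum_(1 <= i < n.+1) (a i * c%:R) *: x ^+ i.
  rewrite big_ltn // mulrDl mulr_suml expr0 !mulr_natr scalerMnl.
  by congr (_ + _); apply: eq_bigr => i _; rewrite !mulr_natr scalerMnl.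
rewrite opprD addrACA -scalerBl -sumrB.
by under [in RHS]eq_bigr => i _ do rewrite scalerBl.
Qed.

Lemma primitive_root_expn_mod (p v : nat) : prime p ->
  is_primitive_root_mod p v -> (v ^ p.-1 = 1 %[mod p])%N.
Proof.
move=> p_pr /prim_expr_order v1.
by rewrite -!(val_Fp_nat p_pr) natrX v1.
Qed.

(** An automorphism is determined by its value on the generator zeta, and the
    k-th power of sigma raises zeta to the power v ^ k. *)
Lemma cyclotomic_gal_expg_eq1 (F : fieldType) (K : splittingFieldType F)
    (zeta : K) (sigma : gal_of {:K}) (p v k : nat) :
  p.-primitive_root zeta -> <<1; zeta>>%VS = {:K}%VS ->
  sigma zeta = zeta ^+ v -> (v ^ k = 1 %[mod p])%N -> (sigma ^+ k)%g = 1%g.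
Proof.
move=> zetaP zetaK sigmaE vk.
have sigmaX j : (sigma ^+ j)%g zeta = zeta ^+ (v ^ j).
  elim: j => [|j IHj]; first by rewrite expg0 gal_id.
  by rewrite expgSr galM ?memvf // IHj rmorphXn /= sigmaE -exprM expnS.
have gal1 x : x \in 'Gal({:K} / 1)%g by rewrite gal_fullT inE.
have zeta_fixed : (sigma ^+ k)%g zeta = zeta.
  by apply/eqP; rewrite sigmaX -[eqbRHS]expr1 (eq_prim_root_expr zetaP) vk.
apply/eqP/gal_eqP => a _.
have /Fadjoin_polyP[q q1 ->] : a \in <<1; zeta>>%VS by rewrite zetaK memvf.
by rewrite gal_id -horner_map (fixedPoly_gal _ (gal1 _)) ?sub1v //= zeta_fixed.
Qed.

(** Both terms of the numerator reduce to v ^ (1 - i) in 'F_p. *)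
Lemma dvdz_delta_num (p v i : nat) : prime p -> (1 <= v <= p.-1)%N ->
  (p%:Z %| delta_num p v i)%Z.
Proof.
move=> p_pr vp; rewrite (dvdz_pcharf (pchar_Fp p_pr)) /delta_num.
have v_neq0 : (v%:R : 'F_p) != 0.
  rewrite -(dvdn_pcharf (pchar_Fp p_pr)); apply/negP => /dvdn_leq.
  have := prime_gt0 p_pr; lia.
have [res1 _] := residue_powP (- (i%:Z - 1)) p_pr vp.
have [res0 _] := residue_powP (- i%:Z) p_pr vp.
rewrite rmorphB rmorphM /= res1 res0 -pmulrn.
by rewrite opprB (addrC 1) expfzDr // expr1z subrr.
Qed.

(** Residues between 1 and p - 1 put the numerator p * delta_i strictly between
    - p ^ 2 and p. *)
Lemma delta_bounds (p v i : nat) : prime p -> (1 <= v <= p.-1)%N ->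
  - p%:Z < delta p v i <= 0.
Proof.
move=> p_pr vp; have p0 := prime_gt0 p_pr.
have := divzK (dvdz_delta_num i p_pr vp); rewrite -/(delta p v i) /delta_num.
have [_] := residue_powP (- (i%:Z - 1)) p_pr vp.
have [_] := residue_powP (- i%:Z) p_pr vp.
move: (residue_pow _ _ _) (residue_pow _ _ _) (delta _ _ _) => r r' d.
move=> rP r'P dE.
by apply/andP; split; nia.
Qed.

Lemma residue_pow0 (p v : nat) : residue_pow p v 0 = 1.
Proof. by rewrite /residue_pow expr0z. Qed.

(** The wrap-around v_{-(p-2)} = v_1, from -(p - 2) = 1 mod p - 1. *)
Lemma residue_pow_wrap (p v : nat) : prime p -> (1 <= v <= p.-1)%N ->
  is_primitive_root_mod p v -> residue_pow p v (- p.-2%:Z) = v.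
Proof.
move=> p_pr vp /prim_expr_order v1; have p2 := prime_gt1 p_pr.
rewrite /residue_pow.
have -> : (v%:R : 'F_p) ^ (- p.-2%:Z) = v%:R.
  rewrite -exprnN; apply: mulr1_eq.
  by rewrite -exprSr -[RHS]v1; congr (_ ^+ _); lia.
rewrite /= val_Fp_nat // modn_small //; lia.
Qed.

Theorem lemma2p4 (p v : nat) (K : splittingFieldType rat) (zeta : K)
    (sigma : gal_of {:K}) :
  prime p -> odd p ->
  p.-primitive_root zeta -> <<1; zeta>>%VS = {:K}%VS ->
  (1 <= v <= p.-1)%N -> is_primitive_root_mod p v ->
  'Gal({:K} / 1)%g = <[sigma]>%g -> sigma zeta = zeta ^+ v ->
  let ZG := group_ring int (gal_of {:K}) in
  let P : ZG := \sum_(0 <= i < p.-1)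
    residue_pow p v (- i%:Z) *: group_elt (sigma ^+ i)%g in
  let Q : ZG := \sum_(1 <= i < p.-1) delta p v i *: group_elt (sigma ^+ i)%g in
  [/\ P * (group_elt sigma - v%:R) = p%:R * Q,
      forall i : nat, (1 <= i <= p - 2)%N -> (p%:Z %| delta_num p v i)%Z
    & forall i : nat, (1 <= i <= p - 2)%N -> - p%:Z < delta p v i <= 0].
Proof.
move=> p_pr p_odd zetaP zetaK vp v_prim _ sigmaE ZG P Q.
have p2 := prime_gt1 p_pr.
split=> [|i _|i _]; [|exact: dvdz_delta_num|exact: delta_bounds].
have sigma1 : (sigma ^+ p.-1)%g = 1%g.
  apply: (cyclotomic_gal_expg_eq1 zetaP zetaK sigmaE).
  exact: primitive_root_expn_mod.
have groupX := @group_eltX int (gal_of {:K}) sigma.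
rewrite /P /Q.
under eq_bigr => i _ do rewrite groupX.
under [X in _ = _ * X]eq_bigr => i _ do rewrite groupX.
rewrite sum_periodic_powers_mulB; [|lia|by rewrite -groupX sigma1].
rewrite oppr0 residue_pow0 residue_pow_wrap // mul1r natz subrr scale0r add0r.
rewrite mulr_natl -sumrMnl; apply: eq_big_nat => i /andP[i1 _].
rewrite -scaler_nat natz scalerA [_ * delta p v i]mulrC divzK ?dvdz_delta_num //.
by rewrite /delta_num predn_int // natz.
Qed.
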